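(* Let $Q\ge2$ be an integer and $n\ge3$. For every non-trivial intersecting family $\mathcal F\subseteq V_n$, $$\Lambda_Q(\mathcal F):=\sum_{S\in\mathcal F}(Q-1)^{n-|S|}\;\le\;Q^{n-1}-(Q-1)^{n-1}+(Q-1),$$ with equality for the one-flip stars $\mathcal F_a^{*}$, $a\in[n]$. For $Q\ge3$ the equality cases are exactly: for $n\ge5$, the $n$ families $\mathcal F_a^{*}$, $a\in[n]$, which are pairwise distinct; for $n=4$, exactly eight families, namely the four $\mathcal F_a^{*}$, $a\in[4]$, and the four triangle systems $\mathcal T_B=\binom{B}{2}\cup\binom{[4]}{3}\cup\{[4]\}$, $B\in\binom{[4]}{3}$; for $n=3$, the unique family $\{\{1,2\},\{1,3\},\{2,3\},\{1,2,3\}\}$, which coincides with every $\mathcal F_a^{*}$. For $Q=2$ every non-trivial maximal intersecting family attains the bound.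
   Context: $[n]=\{1,\dots,n\}$; $V_n$ is the set of nonempty subsets of $[n]$; $\binom{X}{k}$ is the set of $k$-element subsets of $X$. A family $\mathcal F\subseteq V_n$ is intersecting if $A\cap B\ne\varnothing$ for all $A,B\in\mathcal F$. Its kernel is $\ker\mathcal F=\bigcap_{S\in\mathcal F}S$, with $\ker\varnothing=[n]$; an intersecting family is non-trivial (non-condensed) if $\ker\mathcal F=\varnothing$. Maximal means maximal under inclusion among intersecting subfamilies of $V_n$. $\mathrm{Star}(a)=\{S\in V_n:a\in S\}$, and $\mathcal F_a^{*}=(\mathrm{Star}(a)\setminus\{\{a\}\})\cup\{[n]\setminus\{a\}\}$ is the one-flip star at $a$. *)

(* Defs.v *)
(* The ground set [n] is 'I_n, with values 0, ..., n - 1. *)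
From mathcomp Require Export all_boot.

Set Implicit Arguments.
Unset Strict Implicit.
Unset Printing Implicit Defensive.

Definition nonempty_subsets (n : nat) : {set {set 'I_n}} :=
  [set S : {set 'I_n} | S != set0].

Definition subsets_of_card (n : nat) (X : {set 'I_n}) (k : nat) :
    {set {set 'I_n}} :=
  [set S : {set 'I_n} | (S \subset X) && (#|S| == k)].

Definition intersecting (n : nat) (F : {set {set 'I_n}}) : bool :=
  (F \subset nonempty_subsets n) &&
  [forall A in F, forall B in F, A :&: B != set0].

(* The empty intersection is [set: 'I_n]. *)
Definition kernel (n : nat) (F : {set {set 'I_n}}) : {set 'I_n} :=
  \bigcap_(S in F) S.

Definition nontrivial_intersecting (n : nat) (F : {set {set 'I_n}}) : bool :=
  intersecting F && (kernel F == set0).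

Definition maximal_intersecting (n : nat) (F : {set {set 'I_n}}) : bool :=
  maxset (@intersecting n) F.

Definition star (n : nat) (a : 'I_n) : {set {set 'I_n}} :=
  [set S in nonempty_subsets n | a \in S].

Definition one_flip_star (n : nat) (a : 'I_n) : {set {set 'I_n}} :=
  (star a :\ [set a]) :|: [set [set: 'I_n] :\ a].

Definition triangle_system (B : {set 'I_4}) : {set {set 'I_4}} :=
  subsets_of_card B 2 :|: subsets_of_card [set: 'I_4] 3 :|: [set [set: 'I_4]].

Definition Lambda (Q n : nat) (F : {set {set 'I_n}}) : nat :=
  \sum_(S in F) (Q - 1) ^ (n - #|S|).

(* No subtraction here or in Lambda truncates when 0 < Q and 0 < n. *)
Definition Lambda_bound (Q n : nat) : nat :=
  Q ^ (n - 1) - (Q - 1) ^ (n - 1) + (Q - 1).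

Definition extremal_families (Q n : nat) : {set {set {set 'I_n}}} :=
  [set F : {set {set 'I_n}} |
    nontrivial_intersecting F && (Lambda Q F == Lambda_bound Q n)].

Definition pairs_and_triple_3 : {set {set 'I_3}} :=
  let x1 : 'I_3 := inord 0 in
  let x2 : 'I_3 := inord 1 in
  let x3 : 'I_3 := inord 2 in
  [set [set x1; x2]; [set x1; x3]; [set x2; x3]; [set x1; x2; x3]].

(* Main.v *)
(* Put q = Q - 1 and let F be maximal, so that F contains exactly one set of
   each complementary pair. For a <> b let X be the complement of {a, b}, m = n - 2,
   G = {S <= X : a + S in F} and H = {S <= X : S in F}. Duality on X gives
     Lambda F = Q^(m+1) - q sum_G (q^|S| - q^(m-|S|))
                        - sum_H (q^|S| - q^(m+2-|S|)).
   The first sum is at least q^m - 1 for every up-set G that omits the empty set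
   and contains X (induction on X), and for m >= 3, q >= 2 equality forces
   G = {X} or G = all nonempty sets, i.e. a one-flip star; for m = 2 the only
   other possibility is a triangle system. It remains to find
   a, b for which the second sum is nonnegative. If F contains a pair {a, b},
   then H is empty. Otherwise no shift of F becomes trivial, so F may be assumed
   shifted; for a, b the two least points, H is then 3-intersecting, and a
   shifted t-intersecting family satisfies sum_H q^|S| >= q^t sum_H q^(m-|S|),
   so the second sum is even positive when q >= 2. *)
Require Import Defs.
From mathcomp Require Import all_boot perm zify.

Set Implicit Arguments.
Unset Strict Implicit.
Unset Printing Implicit Defensive.

(** * Weights of families of subsets *)

Definition up_closed (T : finType) (P : pred {set T}) : Prop :=
  forall S S' : {set T}, S \subset S' -> P S -> P S'.

(** With [X = setT] and [q = Q - 1] this is [Lambda]. A variable ground set under a predicate on all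
    sets lets an induction delete a point of [X] without restricting [P]. *)
Definition co_weight (T : finType) (q : nat) (X : {set T}) (P : pred {set T}) :=
  \sum_(S : {set T} | S \subset X) P S * q ^ #|X :\: S|.

Definition in_weight (T : finType) (q : nat) (X : {set T}) (P : pred {set T}) :=
  \sum_(S : {set T} | S \subset X) P S * q ^ #|S|.

Lemma sum_subsets_setU1 (T : finType) (x : T) (X : {set T})
    (f : {set T} -> nat) :
  x \notin X ->
  \sum_(S : {set T} | S \subset x |: X) f S =
  \sum_(S : {set T} | S \subset X) f (x |: S) +
  \sum_(S : {set T} | S \subset X) f S.
Proof.
move=> xX; rewrite (bigID (fun S : {set T} => x \in S)) /=; congr (_ + _).
  rewrite (reindex_onto (fun S : {set T} => x |: S) (fun S => S :\ x)) /=;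
    last by move=> S /andP[_ xS]; rewrite setD1K.
  apply: eq_bigl => S; rewrite setU11 andbT.
  apply/andP/idP => [[sub /eqP eS]|sub].
    rewrite -eS; apply/subsetP => y; rewrite in_setD1 => /andP[yx yS].
    by move/subsetP/(_ y yS): sub; rewrite in_setU1 (negPf yx).
  split; first by rewrite setUS.
  by rewrite setU1K //; apply: contra xX; apply: (subsetP sub).
apply: eq_bigl => S; apply/andP/idP => [[sub xS]|sub].
  apply/subsetP => y yS; move/subsetP/(_ y yS): sub; rewrite in_setU1.
  by case/orP=> // /eqP eyx; rewrite -eyx yS in xS.
split; first exact: subset_trans sub (subsetU1 _ _).
by apply: contra xX; apply: (subsetP sub).
Qed.

Lemma co_weight_setU1 (T : finType) (q : nat) (x : T) (X : {set T})
    (P : pred {set T}) :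
  x \notin X ->
  co_weight q (x |: X) P =
  co_weight q X (fun S => P (x |: S)) + q * co_weight q X P.
Proof.
move=> xX; rewrite /co_weight sum_subsets_setU1 // big_distrr /=.
congr (_ + _); apply: eq_bigr => S sub.
  congr (_ * _ ^ _); apply: eq_card => y; rewrite !inE.
  by have [->|] := eqVneq y x; rewrite //= (negPf xX) andbF.
have -> : (x |: X) :\: S = x |: (X :\: S).
  apply/setP => y; rewrite !inE; have [->|] := eqVneq y x => //=.
  by rewrite andbT; apply: contra xX; apply: (subsetP sub).
by rewrite cardsU1 inE (negPf xX) andbF expnS mulnCA.
Qed.

Lemma in_weight_setU1 (T : finType) (q : nat) (x : T) (X : {set T})
    (P : pred {set T}) :
  x \notin X ->
  in_weight q (x |: X) P =
  q * in_weight q X (fun S => P (x |: S)) + in_weight q X P.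
Proof.
move=> xX; rewrite /in_weight sum_subsets_setU1 // big_distrr /=.
congr (_ + _); apply: eq_bigr => S sub.
rewrite cardsU1 (contra _ xX) ?expnS 1?mulnCA //.
exact: (subsetP sub).
Qed.

Lemma co_weight_set0 (T : finType) (q : nat) (P : pred {set T}) :
  co_weight q set0 P = P set0.
Proof.
rewrite /co_weight (big_pred1 set0) => [|S]; last by rewrite subset0.
by rewrite setDv cards0 muln1.
Qed.

Lemma in_weight_set0 (T : finType) (q : nat) (P : pred {set T}) :
  in_weight q set0 P = P set0.
Proof.
rewrite /in_weight (big_pred1 set0) => [|S]; last by rewrite subset0.
by rewrite cards0 muln1.
Qed.

Lemma leq_co_weight (T : finType) (q : nat) (X : {set T})
    (P P' : pred {set T}) :
  (forall S : {set T}, S \subset X -> P S -> P' S) ->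
  co_weight q X P <= co_weight q X P'.
Proof.
move=> PP'; apply: leq_sum => S sub; rewrite leq_mul2r.
by case: (P S) (PP' S sub) => [->|] //; rewrite orbT.
Qed.

Lemma eq_co_weight (T : finType) (q : nat) (X : {set T})
    (P P' : pred {set T}) :
  (forall S : {set T}, S \subset X -> P S = P' S) ->
  co_weight q X P = co_weight q X P'.
Proof. by move=> PP'; apply: eq_bigr => S sub; rewrite PP'. Qed.

Lemma eq_in_weight (T : finType) (q : nat) (X : {set T})
    (P P' : pred {set T}) :
  (forall S : {set T}, S \subset X -> P S = P' S) ->
  in_weight q X P = in_weight q X P'.
Proof. by move=> PP'; apply: eq_bigr => S sub; rewrite PP'. Qed.

Lemma co_weight_pred0 (T : finType) (q : nat) (X : {set T}) :
  co_weight q X pred0 = 0.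
Proof. by rewrite /co_weight big1. Qed.

Lemma in_weight_pred0 (T : finType) (q : nat) (X : {set T}) :
  in_weight q X pred0 = 0.
Proof. by rewrite /in_weight big1. Qed.

Lemma co_weight_predT (T : finType) (q : nat) (X : {set T}) :
  co_weight q X predT = q.+1 ^ #|X|.
Proof.
move: {2}#|X| (erefl #|X|) => m; elim: m X => [|m IH] X.
  by move/cards0_eq->; rewrite co_weight_set0 cards0.
move=> eX; have /set0Pn[x xX] : X != set0 by rewrite -card_gt0 eX.
have cX : #|X :\ x| = m by move: eX; rewrite (cardsD1 x) xX => -[].
rewrite -{1}(setD1K xX) co_weight_setU1 ?setD11 //.
by rewrite (@eq_co_weight _ _ _ _ predT) // IH // cX eX expnS mulSn.
Qed.

Lemma sum_subsets_setD (T : finType) (X : {set T}) (f : {set T} -> nat) :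
  \sum_(S : {set T} | S \subset X) f (X :\: S) =
  \sum_(S : {set T} | S \subset X) f S.
Proof.
have XDK (S : {set T}) : S \subset X -> X :\: (X :\: S) = S.
  by move=> sub; rewrite setDDr setDv set0U; apply/setIidPr.
rewrite [RHS](reindex_onto (setD X) (setD X)) /=; last exact: XDK.
apply: eq_bigl => S; rewrite subsetDl /=.
by apply/idP/eqP => [/XDK|<-] //; rewrite subsetDl.
Qed.

(** Complementation in [X] carries the sets satisfying [P'] to those failing [P] and exchanges the
    two weights, so both sums together run over all subsets of [X]. *)
Lemma co_weight_dual (T : finType) (q : nat) (X : {set T})
    (P P' : pred {set T}) :
  (forall S : {set T}, S \subset X -> P' (X :\: S) = ~~ P S) ->
  co_weight q X P' + in_weight q X P = q.+1 ^ #|X|.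
Proof.
move=> dual; rewrite -co_weight_predT /co_weight -sum_subsets_setD.
rewrite -[in RHS]sum_subsets_setD -big_split /=; apply: eq_bigr => S sub.
rewrite dual // setDDr setDv set0U (setIidPr sub) -mulnDl.
by case: (P S).
Qed.

Lemma in_weight_predT (T : finType) (q : nat) (X : {set T}) :
  in_weight q X predT = q.+1 ^ #|X|.
Proof.
by rewrite -(@co_weight_dual _ q X predT pred0) // co_weight_pred0.
Qed.

Lemma co_weight_ge1 (T : finType) (q : nat) (X S : {set T})
    (P : pred {set T}) :
  0 < q -> S \subset X -> P S -> 0 < co_weight q X P.
Proof.
move=> q0 sub PS; rewrite /co_weight (bigD1 S) //= PS mul1n ltn_addr //.
by rewrite expn_gt0 q0.
Qed.

Lemma co_weight_ge2 (T : finType) (q : nat) (X S S' : {set T})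
    (P : pred {set T}) :
  0 < q -> S \subset X -> S' \subset X -> S != S' -> P S -> P S' ->
  1 < co_weight q X P.
Proof.
move=> q0 sub sub' SS' PS PS'; rewrite /co_weight (bigD1 S) //= PS mul1n.
rewrite (bigD1 S') /=; last by rewrite sub' eq_sym.
rewrite PS' mul1n.
have /= := expn_gt0 q #|X :\: S|; have /= := expn_gt0 q #|X :\: S'|.
by rewrite q0 /=; lia.
Qed.

Lemma co_weight_missing0 (T : finType) (q : nat) (X : {set T})
    (P : pred {set T}) :
  ~~ P set0 -> co_weight q X P + q ^ #|X| <= q.+1 ^ #|X|.
Proof.
move=> P0; rewrite -co_weight_predT /co_weight (bigD1 set0) ?sub0set //=.
rewrite [in X in _ <= X](bigD1 set0) ?sub0set //= (negPf P0) setD0.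
rewrite add0n mul1n addnC leq_add2l; apply: leq_sum => S _.
by case: (P S).
Qed.

Lemma co_weight_missing (T : finType) (q : nat) (X S : {set T})
    (P : pred {set T}) :
  0 < q -> S \subset X -> S != set0 -> ~~ P S -> ~~ P set0 ->
  co_weight q X P + q ^ #|X| < q.+1 ^ #|X|.
Proof.
move=> q0 sub S0 PS P0.
(* Adjoining [S] to [P] still leaves the empty set out and raises the weight by at least [1]. *)
have := @co_weight_missing0 _ q X (fun S' => (S' == S) || P S').
rewrite eq_sym (negPf S0) => /(_ P0); apply: leq_trans; rewrite -addSn leq_add2r.
rewrite /co_weight (bigD1 S) //= (negPf PS) mul0n add0n.
rewrite [in X in _ <= X](bigD1 S) //= eqxx mul1n -add1n leq_add //.
  by rewrite expn_gt0 q0.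
by apply: leq_sum => S' /andP[_ /negPf->].
Qed.

(** * The weight inequality for up-sets *)

(** For [q > 1], division by [q - 1] turns this into [1 + q + ... + q^m <= (q+1)^m], strict from
    [m = 2] on. It settles the up-set of all subsets containing one fixed point. *)
Lemma geometric_bound (q m : nat) :
  0 < q ->
  q.+1 ^ m + q ^ m.+1 <= q * q.+1 ^ m + 1 /\
  (2 <= q -> 2 <= m -> q.+1 ^ m + q ^ m.+1 < q * q.+1 ^ m + 1).
Proof.
move=> q0; elim: m => [|m [IH _]]; first by split; rewrite ?expn0 ?expn1; lia.
have qm : q ^ m.+1 >= q by rewrite -{1}(expn1 q) leq_pexp2l.
have qm2 : 2 <= q -> 1 <= m -> q ^ m.+1 > q.
  by move=> ? ?; rewrite -{1}(expn1 q) ltn_exp2l.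
rewrite !(expnS q m.+1) !(expnS q.+1 m).
move: (q ^ m.+1) (q.+1 ^ m) qm qm2 IH => x y qm qm2 IH.
split; first by nia.
by move=> q2 m1; have := qm2 q2 m1; nia.
Qed.

(** A point [x] of [X] splits [P] into its link [P1] and the members inside [Y = X :\ x]. Only the
    weak inequality passes through the induction; strictness is read off the single split at [x]. *)
Lemma in_weight_lower_bound (T : finType) (q : nat) (X : {set T})
    (P : pred {set T}) :
  0 < q -> up_closed P -> ~~ P set0 -> P X ->
  co_weight q X P + q ^ #|X| <= in_weight q X P + 1 /\
  (2 <= q -> 3 <= #|X| ->
   (exists2 S : {set T}, S \proper X & P S) ->
   (exists2 S : {set T}, (S \subset X) && (S != set0) & ~~ P S) ->
   co_weight q X P + q ^ #|X| < in_weight q X P + 1).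
Proof.
move=> q0; move: {2}#|X| (erefl #|X|) => m.
elim: m X P => [|m IH] X P; first by move/cards0_eq->; case: (P set0).
move=> eX up P0 PX; have /set0Pn[x xX] : X != set0 by rewrite -card_gt0 eX.
set Y := X :\ x; have XE : X = x |: Y by rewrite setD1K.
have xY : x \notin Y by rewrite setD11.
have cY : #|Y| = m by move: eX; rewrite (cardsD1 x) xX => -[].
rewrite eX [in co_weight _ _ _]XE [in in_weight _ _ _]XE.
rewrite co_weight_setU1 // in_weight_setU1 //.
pose P1 : pred {set T} := fun S => P (x |: S).
have up1 : up_closed P1 by move=> S S' sub; apply: up; rewrite setUS.
have P1Y : P1 Y by rewrite /P1 -XE.
have [g1 g2] := geometric_bound m q0.
have a01 : co_weight q Y P <= co_weight q Y P1.
  by apply: leq_co_weight => S _; apply: up; apply: subsetUr.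
have aP0 : ~~ P Y -> co_weight q Y P = 0 /\ in_weight q Y P = 0.
  move=> PY; have PS (S : {set T}) : S \subset Y -> P S = pred0 S.
    by move=> sub; apply/negbTE; apply: contra PY; apply: up.
  rewrite (eq_co_weight _ PS) (eq_in_weight _ PS).
  by rewrite co_weight_pred0 in_weight_pred0.
(* If [[set x]] is a member, the link is the full power set of [Y]. *)
rewrite -/P1; have [P10|P10] := boolP (P1 set0).
  have PS1 (S : {set T}) : S \subset Y -> P1 S = predT S.
    by move=> _; apply: up1 P10; apply: sub0set.
  rewrite (eq_co_weight _ PS1) (eq_in_weight _ PS1).
  rewrite co_weight_predT in_weight_predT cY.
  have [PY|PY] := boolP (P Y); last first.
    by have [-> ->] := aP0 PY; rewrite muln0 !addn0; split=> // q2 m3 _ _; apply: g2.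
  have [IH1 _] := IH _ _ cY up P0 PY; rewrite cY in IH1.
  have := co_weight_missing0 q Y P0; rewrite cY => miss.
  rewrite expnS; split.
    move: (q ^ m) (q.+1 ^ m) (co_weight _ _ _) (in_weight _ _ _) IH1 miss => u v a a'.
    nia.
  move=> q2 m3 _ [S /andP[subS S0] PS].
  have subY : S \subset Y.
    rewrite subsetD1 subS; apply: contra PS => xS; apply: up P10.
    by rewrite setU0 sub1set.
  (* The slack is at least [q - 1] times the co-weight by which [P] falls short of all nonempty
     subsets of [Y]; the absence of [S] makes it positive. *)
  have := co_weight_missing q0 subY S0 PS P0; rewrite cY.
  move: (q ^ m) (q.+1 ^ m) (co_weight _ _ _) (in_weight _ _ _) IH1 => u v a a'.
  move=> IH1 /subnK<-; rewrite -(subnK q2); move: (v - _) (q - 2) => d p.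
  by clear -IH1; nia.
have m1 : 0 < m.
  rewrite lt0n; apply: contra P10 => /eqP m0.
  by move: P1Y; rewrite (cards0_eq (etrans cY m0)).
have [IH1 _] := IH _ _ cY up1 P10 P1Y; rewrite cY in IH1.
have qm : q <= q ^ m by rewrite -{1}(expn1 q) leq_pexp2l.
have [PY|PY] := boolP (P Y); last first.
  have [-> ->] := aP0 PY; rewrite muln0 !addn0 expnS.
  (* With no member inside [Y] the slack is at least [(q - 1)(a - 1)], where [a] is the co-weight of
     the link: [Y] gives [a >= 1], and the second member [S :\ x] gives [a >= 2]. *)
  have c1 := co_weight_ge1 q0 (subxx Y) P1Y; split.
    move: (q ^ m) (co_weight _ _ _) (in_weight _ _ _) IH1 c1 => u a a'.
    nia.
  move=> q2 m3 [S properS PS] _.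
  have xS : x \in S.
    apply: contraR PY => xS; apply: up PS.
    by rewrite subsetD1 xS (proper_sub properS).
  have := @co_weight_ge2 _ q Y Y (S :\ x) P1 q0 (subxx Y).
  have -> : S :\ x \subset Y by rewrite setSD // (proper_sub properS).
  have -> : Y != S :\ x.
    by apply: contraTneq properS => e; rewrite XE e setD1K // properxx.
  rewrite {2}/P1 setD1K // => /(_ isT isT P1Y PS).
  move: (q ^ m) (co_weight _ _ _) (in_weight _ _ _) IH1 => u a a' IH1 a2.
  move: IH1; rewrite -(subnK q2) -(subnK a2); move: (a - 2) (q - 2) => d p IH1.
  by clear -IH1; nia.
(* Both inductive bounds apply. The slack is at least [(q - 1)(a - b) + q^m - q], where the
   co-weights [a] of the link and [b] of [P] on [Y] satisfy [b <= a]; it is positive for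
   [q, m >= 2]. *)
have [IH0 _] := IH _ _ cY up P0 PY; rewrite cY in IH0; rewrite expnS.
split.
  move: (q ^ m) (co_weight _ _ _) (in_weight _ _ _)
    (co_weight _ _ _) (in_weight _ _ _) IH1 IH0 a01 qm => u a a' b b'.
  nia.
move=> q2 m3 _ _.
have qm2 : q < q ^ m by rewrite -{1}(expn1 q) ltn_exp2l.
move: (q ^ m) (co_weight _ _ _) (in_weight _ _ _)
  (co_weight _ _ _) (in_weight _ _ _) IH1 IH0 a01 qm2 => u a a' b b'.
nia.
Qed.

(** * Shifted and t-intersecting families *)

Definition shifted_on (n : nat) (X : {set 'I_n}) (P : pred {set 'I_n}) : Prop :=
  forall (i j : 'I_n) (S : {set 'I_n}), S \subset X -> i \in X -> i < j ->
    j \in S -> i \notin S -> P S -> P (i |: (S :\ j)).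

Definition t_intersecting_on (n t : nat) (X : {set 'I_n})
    (P : pred {set 'I_n}) : Prop :=
  forall S S' : {set 'I_n}, S \subset X -> S' \subset X -> P S -> P S' ->
    t <= #|S :&: S'|.

Lemma shifted_on_setU1 (n : nat) (X : {set 'I_n}) (x : 'I_n) (P : pred {set 'I_n}) :
  shifted_on (x |: X) P -> shifted_on X P.
Proof.
move=> sh i j S sub iX; apply: sh; last by rewrite in_setU1 iX orbT.
exact: subset_trans sub (subsetU1 _ _).
Qed.

Lemma shifted_on_link (n : nat) (X : {set 'I_n}) (x : 'I_n) (P : pred {set 'I_n}) :
  x \notin X -> shifted_on (x |: X) P -> shifted_on X (fun S => P (x |: S)).
Proof.
move=> xX sh i j S sub iX ij jS iS PS.
have ix : i != x by apply: contraNneq xX => <-.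
have jx : j != x by apply: contraNneq xX => <-; apply: (subsetP sub).
have -> : x |: (i |: S :\ j) = i |: ((x |: S) :\ j).
  apply/setP => y; rewrite !inE; have [->|] := eqVneq y x.
    by rewrite (eq_sym x j) jx orbT.
  by [].
apply: sh => //; first by rewrite setUS.
- by rewrite in_setU1 iX orbT.
- by rewrite in_setU1 jS orbT.
- by rewrite in_setU1 negb_or ix.
Qed.

(* Replacing in one of two sets a common element by x would lower their
   intersection. *)
Lemma t_intersecting_on_avoid_min (n t : nat) (X : {set 'I_n}) (x : 'I_n)
    (P : pred {set 'I_n}) :
  x \notin X -> (forall y, y \in X -> x < y) ->
  0 < t -> shifted_on (x |: X) P -> t_intersecting_on t (x |: X) P ->
  t_intersecting_on t.+1 X P.
Proof.
move=> xX xmin t0 sh int S S' sub sub' PS PS'.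
have subU : X \subset x |: X := subsetU1 _ _.
have S1 := subset_trans sub subU; have S1' := subset_trans sub' subU.
have := int _ _ S1 S1' PS PS'; rewrite leq_eqVlt => /predU1P[e|//].
have /set0Pn[j] : S :&: S' != set0 by rewrite -card_gt0 -e.
rewrite inE => /andP[jS jS'].
have xS : x \notin S by apply: contra xX; apply: (subsetP sub).
have xS' : x \notin S' by apply: contra xX; apply: (subsetP sub').
have jX := subsetP sub j jS.
have := sh x j S S1 (setU11 _ _) (xmin _ jX) jS xS PS.
move=> /(int _ _ _ S1')-/(_ _ PS').
have -> : x |: S :\ j \subset x |: X.
  by rewrite setUS // (subset_trans _ sub) // subD1set.
move/(_ isT); rewrite setIUl (_ : [set x] :&: S' = set0); last first.
  apply/setP => y; rewrite !inE; apply: contraNF xS' => /andP[/eqP->] //.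
rewrite set0U e [in X in X <= _](cardsD1 j) inE jS jS' add1n.
rewrite (_ : (S :\ j) :&: S' = (S :&: S') :\ j) ?ltnn //.
by apply/setP => y; rewrite !inE andbA.
Qed.

Lemma t_intersecting_on_link (n t : nat) (X : {set 'I_n}) (x : 'I_n)
    (P : pred {set 'I_n}) :
  x \notin X -> t_intersecting_on t (x |: X) P ->
  t_intersecting_on t.-1 X (fun S => P (x |: S)).
Proof.
move=> xX int S S' sub sub' PS PS'.
have := int _ _ (setUS _ sub) (setUS _ sub') PS PS'.
rewrite -setUIr cardsU1.
have -> : x \notin S :&: S' by rewrite inE; apply: contra xX => /andP[/(subsetP sub)].
by case: t {int} => // t; rewrite ltnS.
Qed.

(* Induction on X: for a shifted family, discarding the least element x makes
   the sets avoiding x intersect in one more element, those containing x in one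
   element less. *)
Lemma t_intersecting_in_weight (n q t : nat) (X : {set 'I_n})
    (P : pred {set 'I_n}) :
  0 < q -> up_closed P -> shifted_on X P -> t_intersecting_on t X P ->
  q ^ t * co_weight q X P <= in_weight q X P.
Proof.
move=> q0; move: {2}#|X| (erefl #|X|) => m.
elim: m X P t => [|m IH] X P t.
  move/cards0_eq=> -> up _ int; rewrite co_weight_set0 in_weight_set0.
  (* Taking both sets equal in [t_intersecting_on] shows that the empty set can be a member only
     when [t = 0]. *)
  case P0: (P set0); last by rewrite muln0.
  by have := int _ _ (sub0set _) (sub0set _) P0 P0; rewrite setI0 cards0; case: t {int}.
move=> eX up sh int.
have /set0Pn[x0 x0X] : X != set0 by rewrite -card_gt0 eX.
have [x xX xmin] : exists2 x, x \in X & forall y, y \in X -> x <= y.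
  by case: (arg_minnP (fun i : 'I_n => i : nat) x0X) => x xX xmin; exists x.
set Y := X :\ x; have XE : X = x |: Y by rewrite setD1K.
have xY : x \notin Y by rewrite setD11.
have cY : #|Y| = m by move: eX; rewrite (cardsD1 x) xX => -[].
have xltY y : y \in Y -> x < y.
  by rewrite in_setD1 ltn_neqAle => /andP[yx /xmin->]; rewrite eq_sym yx.
rewrite XE in sh int *.
rewrite co_weight_setU1 // in_weight_setU1 //.
have up1 : up_closed (fun S => P (x |: S)).
  by move=> S S' sub; apply: up; rewrite setUS.
have IH1 := IH _ _ _ cY up1 (shifted_on_link xY sh) (t_intersecting_on_link xY int).
(* For [t = 0] no power of [q] can be traded between the two parts; the case closes because the
   members inside [Y] form a subfamily of the link. *)
case: t int IH1 => [|t] int IH1.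
  have int0 : t_intersecting_on 0 Y P by [].
  have IH0 := IH _ _ _ cY up (shifted_on_setU1 sh) int0.
  have := @leq_co_weight _ q Y P (fun S => P (x |: S)).
  move/(_ (fun S _ => up S (x |: S) (subsetUr _ _))).
  move: IH1 IH0; rewrite !expn0 !mul1n.
  move: (co_weight _ _ _) (in_weight _ _ _)
    (co_weight _ _ _) (in_weight _ _ _) => a a' b b'.
  nia.
have int2 := t_intersecting_on_avoid_min xY xltY (ltn0Sn t) sh int.
have IH0 := IH _ _ _ cY up (shifted_on_setU1 sh) int2.
rewrite mulnDr leq_add //; last by rewrite mulnA -expnSr.
by rewrite expnS -mulnA leq_mul2l IH1 orbT.
Qed.

(** * Maximal intersecting families and links of a pair *)

Lemma intersectingP (n : nat) (F : {set {set 'I_n}}) :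
  reflect (set0 \notin F /\
           forall S S' : {set 'I_n}, S \in F -> S' \in F -> S :&: S' != set0)
          (intersecting F).
Proof.
apply: (iffP andP) => [[/subsetP ne /forall_inP int]|[F0 int]]; split.
- by apply/negP => /ne; rewrite inE eqxx.
- by move=> S S' /int/forall_inP; apply.
- by apply/subsetP => S SF; rewrite inE; apply: contraNneq F0 => <-.
- by apply/forall_inP => S SF; apply/forall_inP => S'; apply: int.
Qed.

(** The form in which maximality is used: it feeds directly into [co_weight_dual], and shifting
    preserves it. *)
Definition self_dual_intersecting (n : nat) (F : {set {set 'I_n}}) : Prop :=
  intersecting F /\ forall S : {set 'I_n}, (~: S \in F) = (S \notin F).

(** If [S'] were missing, its complement would be a member disjoint from [S]. *)
Lemma self_dual_up_closed (n : nat) (F : {set {set 'I_n}}) :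
  self_dual_intersecting F -> up_closed (fun S => S \in F).
Proof.
case=> /intersectingP[_ int] dual S S' sub SF; apply/negPn; rewrite -dual.
apply/negP => /(int _ _ SF); rewrite -setDE (_ : S :\: S' = set0) ?eqxx //.
by apply/eqP; rewrite setD_eq0.
Qed.

Lemma maximal_mem (n : nat) (F : {set {set 'I_n}}) (S : {set 'I_n}) :
  maximal_intersecting F -> S != set0 ->
  (forall S', S' \in F -> S' :&: S != set0) -> S \in F.
Proof.
case/maxsetP => /intersectingP[F0 int] maxF S0 SF.
rewrite -(maxF (S |: F)) ?setU11 ?subsetU1 //.
apply/intersectingP; split; first by rewrite in_setU1 negb_or eq_sym S0.
move=> A B /setU1P[->|AF] /setU1P[->|BF]; last exact: int.
- by rewrite setIid.
- by rewrite setIC SF.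
- exact: SF.
Qed.

(** If [S] is missing, maximality provides a member disjoint from [S], hence contained in [~: S];
    every member meets it, so every member meets [~: S], which therefore belongs to [F]. *)
Lemma maximal_self_dual (n : nat) (F : {set {set 'I_n}}) :
  0 < n -> maximal_intersecting F -> self_dual_intersecting F.
Proof.
move=> n0 maxF; have [intF _] := maxsetP maxF.
have /intersectingP[F0 int] := intF; split=> // S.
have [SF|SF] := boolP (S \in F).
  by apply/negP => /(int _ _ SF); rewrite setICr eqxx.
have T0 : [set: 'I_n] != set0 by apply/set0Pn; exists (Ordinal n0).
have disj (A : {set 'I_n}) : A \in F -> A :&: ~: S = set0 -> ~: S \in F.
  move=> AF dis; apply/negPn/negP => cSF.
  have AS : A \subset S by rewrite -setD_eq0 setDE dis.
  case/negP: SF; apply: maximal_mem => // [|B BF].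
    by apply: contraTneq AS => ->; rewrite subset0; apply: contraNneq F0 => <-.
  by apply: contra (int _ _ BF AF) => /eqP e; rewrite -subset0 -e setIS.
have [-> |S0] := eqVneq S set0.
  rewrite setC0; apply: maximal_mem => // B BF; rewrite setIT.
  by apply: contraNneq F0 => <-.
have [e|cS0] := eqVneq (~: S) set0.
  case/negP: SF; have -> : S = setT by rewrite -(setCK S) e setC0.
  apply: maximal_mem => // B BF; rewrite setIT.
  by apply: contraNneq F0 => <-.
have [/forall_inP H|] := boolP [forall A in F, A :&: S != set0].
  by case/negP: SF; apply: maximal_mem.
rewrite negb_forall => /existsP[A]; rewrite negb_imply negbK => /andP[AF /eqP e].
have AS : A \subset ~: S by rewrite -disjoints_subset -setI_eq0 e.
apply: maximal_mem => // B BF.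
by apply: contra (int _ _ BF AF) => /eqP e'; rewrite -subset0 -e' setIS.
Qed.

(** * Splitting the weight along a pair of points *)

Lemma Lambda_co_weight (Q n : nat) (F : {set {set 'I_n}}) :
  Lambda Q F = co_weight (Q - 1) setT (fun S => S \in F).
Proof.
rewrite /Lambda /co_weight big_mkcond /=; apply: eq_big => S; first by rewrite subsetT.
move=> _; rewrite setTD [#|~: S|]cardsCs setCK card_ord.
by case: (S \in F); rewrite ?mul1n.
Qed.

(** The terms of [a |: S] and [b |: S] are bracketed because a shift between [a] and [b] moves
    members only within such a bracket. *)
Lemma sum_sets_pair (T : finType) (a b : T) (f : {set T} -> nat) :
  a != b ->
  \sum_(S : {set T}) f S =
  \sum_(S : {set T} | S \subset ~: [set a; b])
    (f (a |: (b |: S)) + (f (a |: S) + f (b |: S)) + f S).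
Proof.
move=> ab; set X := ~: _.
have aX : a \notin b |: X by rewrite !inE (negPf ab) eqxx.
have bX : b \notin X by rewrite !inE eqxx orbT.
have XT : [set: T] = a |: (b |: X).
  by apply/setP => y; rewrite !inE; case: (y == a); case: (y == b).
rewrite (eq_bigl (fun S : {set T} => S \subset a |: (b |: X))); last first.
  by move=> S; rewrite -XT subsetT.
rewrite sum_subsets_setU1 // !sum_subsets_setU1 // !big_split /=.
lia.
Qed.

Lemma co_weight_pair (T : finType) (q : nat) (a b : T) (P : pred {set T}) :
  a != b ->
  let X := ~: [set a; b] in
  co_weight q setT P =
  co_weight q X (fun S => P (a |: (b |: S))) +
  q * (co_weight q X (fun S => P (a |: S)) + co_weight q X (fun S => P (b |: S))) +
  q ^ 2 * co_weight q X P.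
Proof.
move=> ab X.
have aX : a \notin b |: X by rewrite !inE (negPf ab) eqxx.
have bX : b \notin X by rewrite !inE eqxx orbT.
have aX' : a \notin X by rewrite !inE eqxx.
have -> : [set: T] = a |: (b |: X).
  by apply/setP => y; rewrite !inE; case: (y == a); case: (y == b).
rewrite !co_weight_setU1 //; nia.
Qed.

Section Pair.

Variables (n : nat) (F : {set {set 'I_n}}) (a b : 'I_n).
Hypotheses (sdF : self_dual_intersecting F) (ab : a != b).
Let X := ~: [set a; b].
(** [Pa] is the family G; the family H of members avoiding both points is written
    [fun S => S \in F]. *)
Let Pa := fun S : {set 'I_n} => a |: S \in F.

Lemma card_pairC : n = #|X|.+2.
Proof. by have := cardsC [set a; b]; rewrite cards2 ab card_ord => /esym. Qed.

Lemma Lambda_bound_pair (Q : nat) :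
  Lambda_bound Q n = Q ^ #|X|.+1 - (Q - 1) ^ #|X|.+1 + (Q - 1).
Proof.
have -> : #|X|.+1 = n - 1 by have := card_pairC; lia.
by [].
Qed.

(** Complementation expresses the members containing both points through H and those containing only
    [b] through G, so two families carry all the weight. Negative terms stand on the other side to
    avoid truncated subtraction. *)
Lemma self_dual_Lambda_pair (Q : nat) :
  0 < Q ->
  Lambda Q F + in_weight (Q - 1) X (fun S => S \in F) +
    (Q - 1) * in_weight (Q - 1) X Pa =
  Q ^ #|X|.+1 + (Q - 1) * co_weight (Q - 1) X Pa +
    (Q - 1) ^ 2 * co_weight (Q - 1) X (fun S => S \in F).
Proof.
move=> Q0; rewrite Lambda_co_weight (co_weight_pair _ _ ab) -/X -/Pa.
case: sdF => _ dual.
have setCX (S : {set 'I_n}) : S \subset X -> a |: (b |: (X :\: S)) = ~: S.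
  move=> sub; apply/setP => y; rewrite !inE.
  have := subsetP sub y; rewrite !inE; case: (y \in S) => /=.
    by move=> /(_ isT); case: (y == a); case: (y == b).
  by move=> _; case: (y == a); case: (y == b).
have setCaX (S : {set 'I_n}) : S \subset X -> b |: (X :\: S) = ~: (a |: S).
  move=> sub; apply/setP => y; rewrite !inE.
  have := subsetP sub y; rewrite !inE; case: (y \in S) => /=.
    by move=> /(_ isT); case: (y == a); case: (y == b).
  move=> _; have [->|_] := eqVneq y a; first by rewrite (negPf ab).
  by case: (y == b).
have := @co_weight_dual _ (Q - 1) X (fun S => S \in F) (fun S => a |: (b |: S) \in F).
move=> /(_ (fun S sub => etrans (congr1 (fun S => S \in F) (setCX S sub)) (dual S))).
have := @co_weight_dual _ (Q - 1) X Pa (fun S => b |: S \in F).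
move=> /(_ (fun S sub => etrans (congr1 (fun S => S \in F) (setCaX S sub)) (dual _))).
have -> : (Q - 1).+1 = Q by lia.
rewrite [Q ^ #|X|.+1]expnS => e1 e2.
have -> : Q * Q ^ #|X| = (Q - 1) * Q ^ #|X| + Q ^ #|X| by nia.
rewrite -{1}e1 -e2 !mulnDr; clear.
move: (_ ^ 2 * _) (_ * in_weight _ _ _) (in_weight _ _ _).
move: (_ * co_weight _ _ _) (_ * co_weight _ _ _) (co_weight _ _ _).
lia.
Qed.

Hypotheses (aF : [set a] \notin F) (bF : [set b] \notin F).

(** These are the hypotheses of [in_weight_lower_bound]. The last one holds because [a |: X] is the
    complement of [[set b]]. *)
Lemma pair_link_facts : up_closed Pa /\ ~~ Pa set0 /\ Pa X.
Proof.
split; first by move=> S S' sub; apply: self_dual_up_closed => //; rewrite setUS.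
split; first by rewrite /Pa setU0.
rewrite /Pa -[a |: X]setCK sdF.2.
suff -> : ~: (a |: X) = [set b] by [].
apply/setP => y; rewrite !inE; have [->|] := eqVneq y a; first by rewrite (negPf ab).
by rewrite /= negbK.
Qed.

Lemma Lambda_pair_bound (Q : nat) :
  2 <= Q ->
  (Q - 1) ^ 2 * co_weight (Q - 1) X (fun S => S \in F) <=
    in_weight (Q - 1) X (fun S => S \in F) ->
  Lambda Q F <= Lambda_bound Q n.
Proof.
move=> Q2 hH; have := self_dual_Lambda_pair (ltnW Q2).
have [up [P0 PX]] := pair_link_facts.
have q0 : 0 < Q - 1 by lia.
have [+ _] := in_weight_lower_bound q0 up P0 PX.
rewrite Lambda_bound_pair.
have : (Q - 1) ^ #|X|.+1 <= Q ^ #|X|.+1 by rewrite leq_exp2r // leq_subr.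
rewrite [(Q - 1) ^ #|X|.+1]expnS; move: hH; clear.
move: (Lambda Q F) (Q ^ _) ((Q - 1) ^ #|X|) (_ ^ 2 * _).
move: (in_weight _ _ Pa) => ?; move: (in_weight _ _ _) => ?.
move: (Q - 1) (co_weight _ _ Pa).
nia.
Qed.

(** Here the strict gain comes from H. *)
Lemma Lambda_pair_strict (Q : nat) :
  3 <= Q ->
  (Q - 1) ^ 2 * co_weight (Q - 1) X (fun S => S \in F) <
    in_weight (Q - 1) X (fun S => S \in F) ->
  Lambda Q F < Lambda_bound Q n.
Proof.
move=> Q3 hH; have := self_dual_Lambda_pair (ltnW (ltnW Q3)).
have [up [P0 PX]] := pair_link_facts.
have q0 : 0 < Q - 1 by lia.
have [+ _] := in_weight_lower_bound q0 up P0 PX.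
rewrite Lambda_bound_pair.
have : (Q - 1) ^ #|X|.+1 <= Q ^ #|X|.+1 by rewrite leq_exp2r // leq_subr.
rewrite [(Q - 1) ^ #|X|.+1]expnS; move: hH; clear.
move: (Lambda Q F) (Q ^ _) ((Q - 1) ^ #|X|) (_ ^ 2 * _).
move: (in_weight _ _ Pa) => ?; move: (in_weight _ _ _) => ?.
move: (Q - 1) (co_weight _ _ Pa).
nia.
Qed.

(** Here the strict gain comes from G: the two witnesses exclude the extremal up-sets [{X}] and all
    nonempty sets, and [5 <= n] gives [3 <= #|X|]. *)
Lemma Lambda_pair_strict_link (Q : nat) :
  3 <= Q -> 5 <= n -> [set a; b] \in F ->
  (exists2 S : {set 'I_n}, S \proper X & Pa S) ->
  (exists2 S : {set 'I_n}, (S \subset X) && (S != set0) & ~~ Pa S) ->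
  Lambda Q F < Lambda_bound Q n.
Proof.
move=> Q3 n5 abF hS hS'; have := self_dual_Lambda_pair (ltnW (ltnW Q3)).
(* The complement of a subset of [X] contains [[set a; b]] and is thus a member, so H is empty. *)
have F0 (S : {set 'I_n}) : S \subset X -> (S \in F) = pred0 S.
  move=> sub; apply/negbTE; rewrite -sdF.2; apply: self_dual_up_closed abF => //.
  by rewrite -[[set a; b]]setCK setCS.
rewrite (eq_co_weight _ F0) (eq_in_weight _ F0) co_weight_pred0 in_weight_pred0.
have [up [P0 PX]] := pair_link_facts.
have q0 : 0 < Q - 1 by lia.
have q2 : 2 <= Q - 1 by lia.
have X3 : 3 <= #|X| by have := card_pairC; lia.
have [_ /(_ q2 X3 hS hS')] := in_weight_lower_bound q0 up P0 PX.
rewrite Lambda_bound_pair.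
have : (Q - 1) ^ #|X|.+1 <= Q ^ #|X|.+1 by rewrite leq_exp2r // leq_subr.
rewrite [(Q - 1) ^ #|X|.+1]expnS; move: q0; clear.
rewrite muln0 !addn0; move: (Lambda Q F) (Q ^ _) ((Q - 1) ^ #|X|).
move: (in_weight _ _ Pa) => ?; move: (Q - 1) (co_weight _ _ Pa).
nia.
Qed.

Lemma Lambda_pair_mem (Q : nat) :
  2 <= Q -> [set a; b] \in F -> Lambda Q F <= Lambda_bound Q n.
Proof.
move=> Q2 abF; apply: Lambda_pair_bound => //.
have F0 (S : {set 'I_n}) : S \subset X -> (S \in F) = pred0 S.
  move=> sub; apply/negbTE; rewrite -sdF.2; apply: self_dual_up_closed abF => //.
  by rewrite -[[set a; b]]setCK setCS.
by rewrite (eq_co_weight _ F0) co_weight_pred0 muln0.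
Qed.

End Pair.

(** * Shifting *)

Section Shift.

Variables (n : nat) (a b : 'I_n).
Hypothesis ab : a != b.

Definition swap (S : {set 'I_n}) : {set 'I_n} := tperm a b @^-1: S.

(** The compression moving [b] to [a], described by membership instead of as an image, so that
    duality and weight reduce to Boolean checks. *)
Definition shift (F : {set {set 'I_n}}) : {set {set 'I_n}} :=
  [set S : {set 'I_n} |
    if (a \in S) && (b \notin S) then (S \in F) || (swap S \in F)
    else if (a \notin S) && (b \in S) then (S \in F) && (swap S \in F)
    else S \in F].

Lemma card_swap (S : {set 'I_n}) : #|swap S| = #|S|.
Proof. exact: (card_preimset _ (@perm_inj _ (tperm a b))). Qed.

Lemma swap_setC (S : {set 'I_n}) : swap (~: S) = ~: swap S.
Proof. by apply/setP => x; rewrite !inE. Qed.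

Lemma swap_setI (S S' : {set 'I_n}) : swap (S :&: S') = swap S :&: swap S'.
Proof. by apply/setP => x; rewrite !inE. Qed.

Lemma swapK (S : {set 'I_n}) : swap (swap S) = S.
Proof. by apply/setP => x; rewrite !inE tpermK. Qed.

Lemma swap_eq0 (S : {set 'I_n}) : (swap S == set0) = (S == set0).
Proof. by rewrite -!cards_eq0 card_swap. Qed.

Lemma swap_set1U (S : {set 'I_n}) :
  S \subset ~: [set a; b] -> swap (a |: S) = b |: S.
Proof.
move=> sub; have := subsetP sub a; have := subsetP sub b.
rewrite !inE !eqxx orbT => /contraTF/(_ isT) bS /contraTF/(_ isT) aS.
apply/setP => x; rewrite !inE; case: tpermP => [->|->|/eqP/negPf-> /eqP/negPf->] //.
  by rewrite eq_sym (negPf ab) aS bS.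
by rewrite !eqxx.
Qed.

Variable F : {set {set 'I_n}}.

(** Two disjoint sets of the shifted family would yield disjoint members of [F]: the same two sets,
    both swapped, or only the first swapped. *)
Lemma shift_self_dual :
  self_dual_intersecting F -> self_dual_intersecting (shift F).
Proof.
case=> /intersectingP[F0 int] dual; split; last first.
  move=> S; rewrite !inE swap_setC !dual negbK.
  by case: (a \in S); case: (b \in S); case: (S \in F); case: (swap S \in F).
have intN (S S' : {set 'I_n}) : S \in F -> S' \in F -> S :&: S' = set0 -> False.
  by move=> SF S'F /eqP; apply/negP/int.
have disj (S S' : {set 'I_n}) : a \in S -> b \notin S -> b \notin S' ->
    S :&: S' = set0 -> swap S :&: S' = set0.
  move=> aS bS bS' dis; apply/setP => x; rewrite !inE.
  have := congr1 (fun A : {set 'I_n} => x \in A) dis; rewrite !inE.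
  case: tpermP => [->|-> _|//]; first by rewrite (negPf bS).
  by rewrite (negPf bS') andbF.
apply/intersectingP; split.
  by rewrite !inE /=.
(* By symmetry, if [a] lies in one of the two sets, that set is taken to be [S]. *)
suff W (S S' : {set 'I_n}) : S \in shift F -> S' \in shift F ->
    S :&: S' = set0 -> a \in S \/ ((a \notin S) && (a \notin S')) -> False.
  move=> S S' SF S'F; apply/negP => /eqP dis.
  case aS: (a \in S); first by apply: (W S S'); rewrite ?aS; auto.
  case aS': (a \in S'); last by apply: (W S S'); rewrite ?aS ?aS'; auto.
  by apply: (W S' S); rewrite ?aS' 1?setIC; auto.
move=> + + dis aSS'.
have aI : ~~ ((a \in S) && (a \in S')) by rewrite -in_setI dis inE.
have bI : ~~ ((b \in S) && (b \in S')) by rewrite -in_setI dis inE.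
have sdis : swap S :&: swap S' = set0.
  by rewrite -swap_setI dis; apply/eqP; rewrite swap_eq0.
have K := @intN S S'; have K1 := @intN (swap S) (swap S').
have K2 := @intN (swap S) S'.
have D := disj S S'.
rewrite !inE; move: aI bI aSS' D.
case aS: (a \in S); case bS: (b \in S);
 case aS': (a \in S'); case bS': (b \in S') => //=;
 try by [move=> _ _ []|];
 move=> _ _ _ D.
all: repeat (case/andP || case/orP || move=> ?).
all: try by apply: K.
all: try by apply: K1.
all: try by apply: K2 => //; apply: D.
Qed.

Lemma shift_pair (S : {set 'I_n}) :
  S \subset ~: [set a; b] ->
  [/\ (S \in shift F) = (S \in F),
      (a |: (b |: S) \in shift F) = (a |: (b |: S) \in F),
      (a |: S \in shift F) = (a |: S \in F) || (b |: S \in F) &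
      (b |: S \in shift F) = (a |: S \in F) && (b |: S \in F)].
Proof.
move=> sub; have := subsetP sub a; have := subsetP sub b.
rewrite !inE !eqxx orbT => /contraTF/(_ isT) bS /contraTF/(_ isT) aS.
have e : swap (a |: S) = b |: S by apply: swap_set1U.
have e' : swap (b |: S) = a |: S by rewrite -e swapK.
rewrite e e' aS bS (eq_sym b a) (negPf ab) /=.
by split=> //; rewrite andbC.
Qed.

Lemma Lambda_shift (Q : nat) : Lambda Q (shift F) = Lambda Q F.
Proof.
rewrite !Lambda_co_weight !(co_weight_pair _ _ ab).
congr (_ + _ * _ + _ * _).
- by apply: eq_co_weight => S /shift_pair[].
- rewrite /co_weight -!big_split /=; apply: eq_bigr => S /shift_pair[_ _ -> ->].
  by case: (a |: S \in F); case: (b |: S \in F); rewrite /= ?addn0.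
- by apply: eq_co_weight => S /shift_pair[].
Qed.

(** The potential that makes repeated shifting terminate. *)
Definition index_sum (G : {set {set 'I_n}}) : nat :=
  \sum_(S in G) \sum_(i in S) (i : nat).

Lemma index_sum_shift (S : {set 'I_n}) :
  a < b -> a \notin S -> b \in S -> S \in F -> a |: (S :\ b) \notin F ->
  index_sum (shift F) < index_sum F.
Proof.
move=> ltab aS bS SF SF'.
rewrite /index_sum big_mkcond [in X in _ < X]big_mkcond /=.
rewrite !(sum_sets_pair _ ab).
have subS : S :\ b \subset ~: [set a; b].
  apply/subsetP => x; rewrite !inE negb_or => /andP[-> xS]; rewrite andbT.
  by apply: contraNneq aS => <-.
have sumU (c : 'I_n) (A : {set 'I_n}) : c \in [set a; b] -> A \subset ~: [set a; b] ->
    \sum_(i in c |: A) (i : nat) = c + \sum_(i in A) (i : nat).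
  move=> cab sub; rewrite big_setU1 //; apply: contraTN cab => /(subsetP sub).
  by rewrite inE.
have aab : a \in [set a; b] by rewrite set21.
have bab : b \in [set a; b] by rewrite set22.
(* The bracket at [S :\ b] loses [b - a > 0]; no other bracket increases. *)
rewrite (bigD1 (S :\ b)) //= [in X in _ < X](bigD1 (S :\ b)) //=.
rewrite -addSn leq_add //.
  have [-> -> -> ->] := shift_pair subS.
  move: (\sum_(i in a |: (b |: _)) _) => u.
  rewrite (negPf SF') !sumU // setD1K // SF /=.
  by rewrite ltn_add2r ltn_add2l addn0 add0n ltn_add2r.
apply: leq_sum => A /andP[sub _]; have [-> -> -> ->] := shift_pair sub.
move: (\sum_(i in a |: (b |: _)) _) => u; rewrite !sumU //.
rewrite leq_add2r leq_add2l.
case: (a |: A \in F); case: (b |: A \in F) => //=.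
by rewrite addn0 add0n leq_add2r ltnW.
Qed.

End Shift.

(** Shift as long as some shift lowers [index_sum]. The size condition stands in for non-triviality:
    shifts preserve cardinalities, and without singletons the pair bounds stay available. *)
Lemma exists_shifted (Q n : nat) (F : {set {set 'I_n}}) :
  self_dual_intersecting F -> (forall S, S \in F -> 3 <= #|S|) ->
  exists F' : {set {set 'I_n}},
    [/\ self_dual_intersecting F', forall S, S \in F' -> 3 <= #|S|,
        Lambda Q F' = Lambda Q F & shifted_on setT (fun S => S \in F')].
Proof.
have [m] := ubnP (index_sum F); elim: m F => // m IH F ltm sdF F3.
have [/existsP[a /existsP[b /existsP[S /and5P[ltab bS aS SF SF']]]]|nex] := boolP
  [exists a : 'I_n, exists b : 'I_n, exists S : {set 'I_n},
    [&& a < b, b \in S, a \notin S, S \in F & a |: (S :\ b) \notin F]].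
  have ab : a != b by rewrite neq_ltn ltab.
  have lt := index_sum_shift ab ltab aS bS SF SF'.
  have [||F' [? ? e ?]] := IH (shift a b F) _ (shift_self_dual a b sdF).
  - exact: leq_trans lt ltm.
  - move=> A; rewrite inE; rewrite -[#|A|](card_swap a b).
    case: ifP => _; first by case/orP => /F3; rewrite ?card_swap.
    by case: ifP => _; first case/andP; move=> /F3; rewrite ?card_swap.
  by exists F'; split=> //; rewrite e Lambda_shift.
exists F; split=> // i j S _ _ ltij jS iS SF; apply: contraR nex => SF'.
by apply/existsP; exists i; apply/existsP; exists j; apply/existsP; exists S;
  apply/and5P.
Qed.

Lemma Lambda_no_pair (Q n : nat) (F : {set {set 'I_n}}) :
  2 <= Q -> 2 <= n -> self_dual_intersecting F ->
  (forall S, S \in F -> 3 <= #|S|) ->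
  Lambda Q F <= Lambda_bound Q n /\ (3 <= Q -> Lambda Q F < Lambda_bound Q n).
Proof.
move=> Q2 n2 sdF F3; have [F' [sdF' F3' <- shF']] := exists_shifted Q sdF F3.
have n1 := ltnW n2.
(* These are the two least points, as [t_intersecting_on_avoid_min] requires when they are deleted
   in turn. *)
pose a := Ordinal n1; pose b := Ordinal n2.
have ab : a != b by [].
set X := ~: [set a; b].
have aF : [set a] \notin F' by apply/negP => /F3'; rewrite cards1.
have bF : [set b] \notin F' by apply/negP => /F3'; rewrite cards1.
have abF : [set a; b] \notin F' by apply/negP => /F3'; rewrite cards2.
have up := self_dual_up_closed sdF'.
have XF : X \in F' by rewrite sdF'.2.
have aX : a \notin b |: X by rewrite !inE.
have bX : b \notin X by rewrite !inE eqxx orbT.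
have XT : setT = a |: (b |: X).
  by apply/setP => y; rewrite !inE; case: (y == a); case: (y == b).
have int1 : t_intersecting_on 1 (a |: (b |: X)) (fun S => S \in F').
  move=> S S' _ _ SF S'F; rewrite card_gt0.
  by have /intersectingP[_] := sdF'.1; apply.
rewrite XT in shF'.
have int2 : t_intersecting_on 2 (b |: X) (fun S => S \in F').
  apply: (t_intersecting_on_avoid_min aX _ _ shF' int1) => // y.
  move=> yX; rewrite lt0n; apply: contraTneq yX => y0.
  by rewrite (_ : y = a) //; apply: ord_inj.
have int3 : t_intersecting_on 3 X (fun S => S \in F').
  apply: (t_intersecting_on_avoid_min bX _ _ (shifted_on_setU1 shF') int2) => // y.
  rewrite !inE negb_or -!val_eqE /=; lia.
have q0 : 0 < Q - 1 by lia.
have := t_intersecting_in_weight q0 up (shifted_on_setU1 (shifted_on_setU1 shF')) int3.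
(* The exponent [3] is one more than the pair bound asks for. As [X] itself belongs to H, the spare
   factor [Q - 1] gives strictness for [3 <= Q]. *)
rewrite [_ ^ 3]expnS => le3.
have H0 : 0 < co_weight (Q - 1) X (fun S => S \in F').
  exact: co_weight_ge1 q0 (subxx X) XF.
split.
  apply: (Lambda_pair_bound sdF' ab) => //; apply: leq_trans le3.
  by rewrite leq_mul2r leq_pmull ?orbT.
move=> Q3; apply: (Lambda_pair_strict sdF' ab) => //; apply: leq_trans le3.
rewrite -mulnA ltn_Pmull ?muln_gt0 ?H0 ?expn_gt0 ?q0 //; lia.
Qed.

(** * Extremal families *)

Lemma exists_notin (n : nat) (A : {set 'I_n}) : #|A| < n -> exists x, x \notin A.
Proof.
move=> ltA; have /set0Pn[x] : ~: A != set0.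
  by rewrite -card_gt0; have := cardsC A; rewrite card_ord; lia.
by rewrite inE; exists x.
Qed.

Lemma leq_cardsD1 (T : finType) (x : T) (A : {set T}) : #|A| <= #|A :\ x|.+1.
Proof. by rewrite (cardsD1 x A) -add1n leq_add2r leq_b1. Qed.

Lemma kernel_eq0P (n : nat) (F : {set {set 'I_n}}) :
  reflect (forall x, exists2 S, S \in F & x \notin S) (kernel F == set0).
Proof.
apply: (iffP eqP) => [k0 x|H].
  have : x \notin kernel F by rewrite k0 inE.
  by rewrite -in_setC setC_bigcap => /bigcupP[S SF]; rewrite inE; exists S.
apply/setP => x; rewrite inE; apply/negbTE; have [S SF] := H x.
by apply: contra => /bigcapP; apply.
Qed.

(** A member [[set a]] would force [a] into every member, hence into the kernel. *)
Lemma nontrivial_notin_set1 (n : nat) (F : {set {set 'I_n}}) (a : 'I_n) :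
  nontrivial_intersecting F -> [set a] \notin F.
Proof.
case/andP => /intersectingP[_ int] /kernel_eq0P/(_ a)[S SF aS].
apply: contra aS => /(int _ _ SF)/set0Pn[x].
by rewrite !inE => /andP[xS /eqP <-].
Qed.

Lemma maximal_extension (n : nat) (F : {set {set 'I_n}}) :
  nontrivial_intersecting F ->
  exists F' : {set {set 'I_n}},
    [/\ F \subset F', maximal_intersecting F' & nontrivial_intersecting F'].
Proof.
case/andP => intF /kernel_eq0P kF; have [F' maxF' sub] := maxset_exists intF.
exists F'; split=> //; rewrite /nontrivial_intersecting (maxsetp maxF') /=.
by apply/kernel_eq0P => x; have [S SF] := kF x; exists S; rewrite ?(subsetP sub).
Qed.

(** Every weight is positive for [2 <= Q], so a proper subfamily weighs strictly less. *)
Lemma Lambda_subset (Q n : nat) (F F' : {set {set 'I_n}}) :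
  2 <= Q -> F \subset F' -> Lambda Q F <= Lambda Q F' ?= iff (F == F').
Proof.
move=> Q2 sub; have [->|neq] := eqVneq F F'; first exact: leqif_refl.
have /properP[_ [S SF' SF]] : F \proper F' by rewrite properEneq neq.
apply/leqifP; rewrite /Lambda [in X in _ < X](big_setID F) /=.
rewrite (setIidPr sub) -[X in X < _]addn0 ltn_add2l.
rewrite (bigD1 S) ?inE ?SF ?SF' //= ltn_addr // expn_gt0; lia.
Qed.

Lemma set2_in_or_card_ge3 (n : nat) (F : {set {set 'I_n}}) :
  nontrivial_intersecting F ->
  (exists a b, a != b /\ [set a; b] \in F) \/ (forall S, S \in F -> 3 <= #|S|).
Proof.
move=> ntF; have [/forall_inP H|] := boolP [forall S in F, 3 <= #|S|].
  by right.
rewrite negb_forall => /existsP[S]; rewrite negb_imply -ltnNge ltnS => /andP[SF].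
rewrite leq_eqVlt => /orP[/cards2P[a [b [ab e]]]|].
  by left; exists a, b; rewrite -e.
rewrite ltnS leq_eqVlt ltnS leqn0 cards_eq0 => /orP[/cards1P[a e]|/eqP e].
  by have := nontrivial_notin_set1 a ntF; rewrite -e SF.
by case/andP: ntF => /intersectingP[F0]; rewrite -e SF in F0.
Qed.

Lemma nontrivial_Lambda_le (Q n : nat) (F : {set {set 'I_n}}) :
  2 <= Q -> 3 <= n -> nontrivial_intersecting F ->
  Lambda Q F <= Lambda_bound Q n.
Proof.
move=> Q2 n3 /maximal_extension[F' [sub maxF ntF]].
apply: leq_trans (Lambda_subset Q2 sub) _.
have sdF := maximal_self_dual (ltnW (ltnW n3)) maxF.
have [[a [b [ab abF]]]|F3] := set2_in_or_card_ge3 ntF.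
  by apply: (Lambda_pair_mem sdF ab) => //; apply: nontrivial_notin_set1.
by have [] := Lambda_no_pair Q2 (ltnW n3) sdF F3.
Qed.

(** A maximal extension is still non-trivial, hence obeys the bound that [F] already attains, so it
    weighs no more than [F]. *)
Lemma extremal_maximal (Q n : nat) (F : {set {set 'I_n}}) :
  2 <= Q -> 3 <= n -> F \in extremal_families Q n -> maximal_intersecting F.
Proof.
move=> Q2 n3; rewrite inE => /andP[/maximal_extension[F' [sub maxF ntF]] /eqP e].
suff /eqP-> : F == F' by [].
rewrite -(Lambda_subset Q2 sub).2 eqn_leq (Lambda_subset Q2 sub) e.
exact: nontrivial_Lambda_le.
Qed.

Lemma extremal_pair (Q n : nat) (F : {set {set 'I_n}}) :
  3 <= Q -> 3 <= n -> F \in extremal_families Q n ->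
  exists a b, a != b /\ [set a; b] \in F.
Proof.
move=> Q3 n3 extF; have maxF := extremal_maximal (ltnW Q3) n3 extF.
have sdF := maximal_self_dual (ltnW (ltnW n3)) maxF.
move: extF; rewrite inE => /andP[ntF /eqP e].
have [//|F3] := set2_in_or_card_ge3 ntF.
have [_ /(_ Q3)] := Lambda_no_pair (ltnW Q3) (ltnW n3) sdF F3.
by rewrite e ltnn.
Qed.

(** * One-flip stars *)

Lemma mem_one_flip_star (n : nat) (a : 'I_n) (S : {set 'I_n}) :
  (S \in one_flip_star a) =
  if a \in S then S != [set a] else S == ~: [set a].
Proof.
rewrite !inE setTD; case aS: (a \in S).
  rewrite andbT (_ : S != set0); last by apply/set0Pn; exists a.
  rewrite andbT; case: eqP => [->|//] /=; apply/eqP => e.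
  by have := set11 a; rewrite e !inE eqxx.
by rewrite !andbF.
Qed.

(** Up-closure from the pairs decides every set containing [a]; self-duality then decides the
    others. *)
Lemma one_flip_star_unique (n : nat) (F : {set {set 'I_n}}) (a : 'I_n) :
  self_dual_intersecting F -> [set a] \notin F ->
  (forall c, c != a -> [set a; c] \in F) -> F = one_flip_star a.
Proof.
move=> sdF aF acF.
have memF (S : {set 'I_n}) : a \in S -> (S \in F) = (S != [set a]).
  move=> aS; apply/idP/idP => [SF|]; first by apply: contraNneq aF => <-.
  move=> Sa; have /subsetPn[c cS] : ~~ (S \subset [set a]).
    by apply: contra Sa => sub; rewrite eqEsubset sub sub1set.
  rewrite inE => /acF; apply: self_dual_up_closed => //.
  by rewrite subUset !sub1set aS.
apply/setP => S; rewrite mem_one_flip_star; case: ifP => aS; first exact: memF.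
by rewrite -[S]setCK sdF.2 memF ?inE ?aS // negbK setCK (can2_eq setCK setCK).
Qed.

(** The points [c] and [d] certify that [F] is neither star; they may coincide. They become the two
    witnesses required by [Lambda_pair_strict_link]. *)
Lemma pair_trichotomy (n : nat) (F : {set {set 'I_n}}) (a b : 'I_n) :
  self_dual_intersecting F -> [set a] \notin F -> [set b] \notin F ->
  [set a; b] \in F ->
  [\/ F = one_flip_star a, F = one_flip_star b |
      exists c d, [/\ c \notin [set a; b], d \notin [set a; b],
                      [set a; c] \notin F & [set b; d] \notin F]].
Proof.
move=> sdF aF bF abF.
have [/forall_inP Ha|] := boolP [forall (c | c != a), [set a; c] \in F].
  by apply: Or31; apply: one_flip_star_unique.
rewrite negb_forall => /existsP[c]; rewrite negb_imply => /andP[ca acF].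
have [/forall_inP Hb|] := boolP [forall (d | d != b), [set b; d] \in F].
  by apply: Or32; apply: one_flip_star_unique.
rewrite negb_forall => /existsP[d]; rewrite negb_imply => /andP[db bdF].
apply: Or33; exists c, d; split=> //; rewrite !inE negb_or.
  by rewrite ca; apply: contraNneq acF => ->.
by rewrite db andbT; apply: contraNneq bdF => ->; rewrite setUC.
Qed.

Lemma one_flip_star_nontrivial (n : nat) (a : 'I_n) :
  3 <= n -> nontrivial_intersecting (one_flip_star a).
Proof.
move=> n3; apply/andP; split.
  apply/intersectingP; rewrite mem_one_flip_star inE; split.
    rewrite eq_sym -cards_eq0 -lt0n.
    by rewrite cardsC1 card_ord; lia.
  have ac (S : {set 'I_n}) : S != [set a] -> a \in S -> S :&: ~: [set a] != set0.
    move=> Sa aS; apply: contra Sa; rewrite -setDE setD_eq0 => sub.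
    by rewrite eqEsubset sub sub1set.
  move=> S S'; rewrite !mem_one_flip_star; case: ifP => aS; case: ifP => aS' //.
  - by move=> _ _; apply/set0Pn; exists a; rewrite inE aS.
  - by move=> Sa /eqP->; apply: ac.
  - by move=> /eqP-> Sa; rewrite setIC; apply: ac.
  - move=> /eqP-> /eqP->; rewrite setIid -card_gt0.
    by rewrite cardsC1 card_ord; lia.
apply/kernel_eq0P => x; have [->|xa] := eqVneq x a.
  by exists (~: [set a]); rewrite ?mem_one_flip_star !inE ?eqxx.
have [|c] := @exists_notin n [set a; x]; first by rewrite cards2; lia.
rewrite !inE negb_or => /andP[ca cx].
exists [set a; c]; last by rewrite !inE negb_or xa eq_sym.
rewrite mem_one_flip_star !inE eqxx /=; apply: contraNneq ca => e.
by rewrite -in_set1 -e !inE eqxx orbT.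
Qed.

Lemma Lambda_star (Q n : nat) (a : 'I_n) : 0 < Q -> Lambda Q (star a) = Q ^ (n - 1).
Proof.
move=> Q0; rewrite Lambda_co_weight.
have aX : a \notin ~: [set a] by rewrite !inE eqxx.
have -> : setT = a |: ~: [set a] by apply/setP => y; rewrite !inE orbN.
rewrite co_weight_setU1 // (@eq_co_weight _ _ _ _ predT); last first.
  move=> S _; rewrite !inE eqxx andbT; apply/set0Pn; exists a.
  by rewrite setU11.
rewrite (@eq_co_weight _ _ _ (fun S => S \in star a) pred0); last first.
  move=> S sub; rewrite !inE; apply/negbTE; rewrite negb_and.
  by rewrite (contra (subsetP sub a)) ?orbT // !inE eqxx.
rewrite co_weight_pred0 muln0 addn0 co_weight_predT.
have -> : (Q - 1).+1 = Q by lia.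
by rewrite cardsC1 card_ord subn1.
Qed.

Lemma Lambda_one_flip_star (Q n : nat) (a : 'I_n) :
  2 <= Q -> 3 <= n -> Lambda Q (one_flip_star a) = Lambda_bound Q n.
Proof.
move=> Q2 n3; rewrite /Lambda_bound -(Lambda_star a (ltnW Q2)) /Lambda.
rewrite [in RHS](big_setD1 [set a]) /=; last first.
  by rewrite !inE eqxx andbT; apply/set0Pn; exists a; rewrite set11.
rewrite /one_flip_star setUC big_setU1 /=; last by rewrite !inE eqxx !andbF.
rewrite cards1 addKn addnC setTD cardsC1 card_ord.
have -> : n - n.-1 = 1 by lia.
by rewrite expn1.
Qed.

(** A pair [[set a; c]] avoiding [b] could lie in the star flipped at [b] only as the complement of
    [b], which has at least three elements once [4 <= n]. *)
Lemma one_flip_star_inj (n : nat) : 4 <= n -> injective (@one_flip_star n).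
Proof.
move=> n4 a b e; apply/eqP/negPn/negP => ab.
have [|c] := @exists_notin n [set a; b]; first by rewrite cards2; lia.
rewrite !inE negb_or => /andP[ca cb].
have : [set a; c] \in one_flip_star b.
  rewrite -e mem_one_flip_star !inE eqxx /=; apply: contraNneq ca => e'.
  by rewrite -in_set1 -e' !inE eqxx orbT.
rewrite mem_one_flip_star !inE (eq_sym b a) (negPf ab) (eq_sym b c) (negPf cb) /=.
move=> /eqP/(congr1 (fun A : {set 'I_n} => #|A|)).
rewrite cards2 eq_sym ca cardsC1 card_ord; lia.
Qed.

Lemma extremal_families_ge5 (Q n : nat) :
  3 <= Q -> 5 <= n -> extremal_families Q n = [set one_flip_star a | a : 'I_n].
Proof.
move=> Q3 n5; have n3 : 3 <= n by lia.
apply/setP => F; apply/idP/imsetP => [extF|[a _ ->]]; last first.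
  by rewrite inE one_flip_star_nontrivial // Lambda_one_flip_star ?eqxx ?(ltnW Q3).
have maxF := extremal_maximal (ltnW Q3) n3 extF.
have sdF := maximal_self_dual (ltnW (ltnW n3)) maxF.
have [a [b [ab abF]]] := extremal_pair Q3 n3 extF.
move: extF; rewrite inE => /andP[ntF /eqP e].
have F1 x := nontrivial_notin_set1 x ntF.
have [->|->|[c [d [cab dab acF bdF]]]] := pair_trichotomy sdF (F1 a) (F1 b) abF.
- by exists a.
- by exists b.
have := @Lambda_pair_strict_link n F a b sdF ab (F1 a) (F1 b) Q Q3 n5 abF.
rewrite e ltnn => H; suff: false by []; apply: H.
  (* This set is in the link of [a] because adding [a] gives the complement of [[set b; d]]. The
     second witness, [[set c]], is outside the link. *)
  exists (~: [set a; b] :\ d).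
    by apply: properD1; rewrite inE.
  suff -> : a |: (~: [set a; b] :\ d) = ~: [set b; d] by rewrite sdF.2.
  apply/setP => x; rewrite !inE; move: dab; rewrite !inE negb_or => /andP[da db].
  have [->|_] := eqVneq x a; first by rewrite (negPf ab) eq_sym da.
  by rewrite /= negb_or andbC.
exists [set c] => //; rewrite sub1set inE cab /=.
by apply/set0Pn; exists c; rewrite set11.
Qed.

(** * Four points and the triangle systems *)

(** This is the majority family on [B]. A triple or the whole set omits at most one point of [B];
    conversely, a two-element set with two points in [B] lies inside [B]. *)
Lemma mem_triangle_system (B S : {set 'I_4}) :
  #|B| = 3 -> (S \in triangle_system B) = (2 <= #|S :&: B|).
Proof.
move=> B3; rewrite !inE subsetT /=.
have cB : #|~: B| = 1 by have := cardsC B; rewrite card_ord B3 => -[].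
have := cardsID B S; have := subset_leq_card (subsetIr S B); rewrite B3 => SB SID.
have SD : #|S :\: B| <= 1.
  by rewrite setDE -[X in _ <= X]cB subset_leq_card // subsetIr.
apply/idP/idP.
  case/orP => [/orP[/andP[/setIidPl-> /eqP->]//|/eqP S3]|/eqP ST]; first last.
    by rewrite ST setTI B3.
  move: SID SD; rewrite S3; move: #|_ :&: _| #|_ :\: _|; lia.
move=> SB2; case: (ltngtP #|S| 3) => [S3|S3|_]; last by rewrite orbT.
  have SleSB : #|S| <= #|S :&: B| by apply: leq_trans SB2.
  have -> : S \subset B by apply/setIidPl/eqP; rewrite eqEcard subsetIl.
  have S2 : 2 <= #|S| by apply: leq_trans SB2 (subset_leq_card (subsetIl _ _)).
  by rewrite eqn_leq S2 -ltnS S3.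
by rewrite eqEcard subsetT cardsT card_ord S3 orbT.
Qed.

(** Two majorities of a three-element set overlap by pigeonhole, and [B :\ x] is a majority avoiding
    [x]. *)
Lemma triangle_system_nontrivial (B : {set 'I_4}) :
  #|B| = 3 -> nontrivial_intersecting (triangle_system B).
Proof.
move=> B3; apply/andP; split.
  apply/intersectingP; rewrite mem_triangle_system // set0I cards0; split=> //.
  move=> S S'; rewrite !mem_triangle_system // => S2 S2'.
  have := cardsUI (S :&: B) (S' :&: B).
  have := subset_leq_card (subsetIr (S :|: S') B); rewrite setIUl B3 => le3 eqU.
  have /set0Pn[x] : (S :&: B) :&: (S' :&: B) != set0 by rewrite -card_gt0; lia.
  by rewrite !inE => /andP[/andP[xS _] /andP[xS' _]]; apply/set0Pn;
    exists x; rewrite inE xS.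
apply/kernel_eq0P => x; exists (B :\ x); last by rewrite setD11.
rewrite mem_triangle_system // (setIidPl (subD1set _ _)).
by have := leq_cardsD1 x B; rewrite B3.
Qed.

Lemma sum_subsets_of_card (n k : nat) (X : {set 'I_n}) (q : nat) :
  \sum_(S in subsets_of_card X k) q ^ (n - #|S|) = 'C(#|X|, k) * q ^ (n - k).
Proof.
rewrite -cards_draws -sum_nat_const; apply: eq_bigr => S.
by rewrite inE => /andP[_ /eqP->].
Qed.

Lemma Lambda_triangle_system (Q : nat) (B : {set 'I_4}) :
  2 <= Q -> #|B| = 3 -> Lambda Q (triangle_system B) = Lambda_bound Q 4.
Proof.
move=> Q2 B3; rewrite /Lambda /triangle_system.
rewrite setUC big_setU1 /=; last first.
  by rewrite !inE cardsT card_ord /= !andbF.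
rewrite (big_setID (subsets_of_card B 2)) /= setUK.
rewrite (_ : _ :\: _ = subsets_of_card setT 3); last first.
  rewrite setDUl setDv set0U; apply/setDidPl/pred0P => S; rewrite /= !inE.
  by case: (#|S| =P 3) => [->|]; rewrite ?andbF.
rewrite !sum_subsets_of_card B3 cardsT card_ord /Lambda_bound.
have -> : 'C(3, 2) = 3 by []. have -> : 'C(4, 3) = 4 by [].
rewrite !subnn !subSS !subn0 !expnS !expn0.
(* With [q = Q - 1] the count [3q^2 + 4q + 1] must equal [(q+1)^3 - q^3 + q]; the selected
   occurrences are the three factors of [Q ^ 3]. *)
rewrite -{4 5 6}(subnK (ltnW Q2)); move: (Q - 1) => q; nia.
Qed.

(** For [x] in [B] but not in [B'], a pair in [B] through [x] has at most one point in [B']. *)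
Lemma triangle_system_inj :
  {in subsets_of_card [set: 'I_4] 3 &, injective triangle_system}.
Proof.
move=> B B'; rewrite !inE !subsetT /= => /eqP B3 /eqP B3' e.
apply/eqP; rewrite eqEcard B3 B3' leqnn andbT; apply/subsetP => x xB.
apply/negPn/negP => xB'.
have cB : #|B :\ x| = 2 by move: B3; rewrite (cardsD1 x B) xB => -[].
have /set0Pn[y yB] : B :\ x != set0 by rewrite -card_gt0 cB.
move: yB; rewrite !inE => /andP[yx yB].
have : [set x; y] \in triangle_system B'.
  rewrite -e mem_triangle_system // (setIidPl _) ?cards2 1?eq_sym ?yx //.
  by rewrite subUset !sub1set xB.
rewrite mem_triangle_system // setIUl.
rewrite (_ : [set x] :&: B' = set0) ?set0U.
  by have := subset_leq_card (subsetIl [set y] B'); rewrite cards1; lia.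
by apply/setP => z; rewrite !inE; apply: contraNF xB' => /andP[/eqP<-].
Qed.

(** Two points of [B] other than [a] form a member avoiding [a]; in the flipped star such a member
    has three elements. *)
Lemma triangle_system_neq_one_flip_star (B : {set 'I_4}) (a : 'I_4) :
  #|B| = 3 -> triangle_system B <> one_flip_star a.
Proof.
move=> B3 e.
have [b bB ba] : exists2 b, b \in B & b != a.
  have /set0Pn[b] : B :\ a != set0.
    by rewrite -card_gt0; have := leq_cardsD1 a B; rewrite B3 => /ltnW.
  by rewrite !inE => /andP[]; exists b.
have [c cB] : exists c, c \in (B :\ a) :\ b.
  apply/set0Pn; rewrite -card_gt0 -ltnS.
  by apply: leq_trans (leq_cardsD1 b _); have := leq_cardsD1 a B; rewrite B3.
move: cB; rewrite !inE => /and3P[cb ca cB].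
have : [set b; c] \in one_flip_star a.
  rewrite -e mem_triangle_system // (setIidPl _) ?cards2 1?eq_sym ?cb //.
  by rewrite subUset !sub1set bB.
rewrite mem_one_flip_star !inE !(eq_sym a) (negPf ba) (negPf ca) /=.
move=> /eqP/(congr1 (fun A : {set 'I_4} => #|A|)).
rewrite cards2 eq_sym cb cardsC1 card_ord; lia.
Qed.

(** If [F] is neither star from the trichotomy, let [e] be the fourth point beside [a], [b], [c].
    Complements of missing pairs give [[set b; e]], then [d = c], then [[set a; e]], so all pairs in
    [B = [set a; b; e]] are members. *)
Lemma extremal_families_4 (Q : nat) :
  3 <= Q ->
  extremal_families Q 4 =
    [set one_flip_star a | a : 'I_4] :|:
    [set triangle_system B | B in subsets_of_card [set: 'I_4] 3].
Proof.
move=> Q3; apply/setP => F; apply/idP/setUP; last first.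
  case=> /imsetP[].
    move=> a _ ->.
    by rewrite inE one_flip_star_nontrivial // Lambda_one_flip_star ?eqxx ?(ltnW Q3).
  move=> B; rewrite inE subsetT => /eqP B3 ->.
  by rewrite inE triangle_system_nontrivial // Lambda_triangle_system ?eqxx ?(ltnW Q3).
move=> extF; have maxF := extremal_maximal (ltnW Q3) (isT : 2 < 4) extF.
have sdF := maximal_self_dual (isT : 0 < 4) maxF.
have up := self_dual_up_closed sdF.
have [a [b [ab abF]]] := extremal_pair Q3 (isT : 2 < 4) extF.
move: extF; rewrite inE => /andP[ntF _].
have F1 x := nontrivial_notin_set1 x ntF.
have [->|->|[c [d [cab dab acF bdF]]]] := pair_trichotomy sdF (F1 a) (F1 b) abF.
- by left; apply: imset_f.
- by left; apply: imset_f.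
have [|e] := @exists_notin _ (c |: [set a; b]); first by rewrite cardsU1 cab cards2 ab.
rewrite in_setU1 negb_or => /andP[ec eab].
have T x : [|| x == e, x == c, x == a | x == b].
  have : x \in e |: (c |: [set a; b]); last by rewrite !inE.
  suff -> : e |: (c |: [set a; b]) = setT by rewrite inE.
  apply/eqP; rewrite eqEcard subsetT cardsT card_ord cardsU1 cardsU1 cab cards2 ab.
  by rewrite in_setU1 negb_or ec eab.
move: cab dab eab; rewrite !inE !negb_or => /andP[ca cb] /andP[da db] /andP[ea eb].
have beF : [set b; e] \in F.
  suff -> : [set b; e] = ~: [set a; c] by rewrite sdF.2.
  apply/setP => x; rewrite !inE; case/or4P: (T x) => /eqP->.
  - by rewrite eqxx orbT negb_or ea ec.
  - by rewrite eqxx orbT (negPf cb) eq_sym (negPf ec).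
  - by rewrite eqxx (negPf ab) eq_sym (negPf ea).
  - by rewrite eqxx /= negb_or (eq_sym b a) ab eq_sym cb.
have dc : d = c.
  case/or4P: (T d) => /eqP ed //; [| by rewrite ed eqxx in da | by rewrite ed eqxx in db].
  by rewrite ed beF in bdF.
have aeF : [set a; e] \in F.
  suff -> : [set a; e] = ~: [set b; c] by rewrite sdF.2 -dc.
  apply/setP => x; rewrite !inE; case/or4P: (T x) => /eqP->.
  - by rewrite eqxx orbT negb_or eb ec.
  - by rewrite eqxx orbT (negPf ca) eq_sym (negPf ec).
  - by rewrite eqxx /= negb_or ab eq_sym ca.
  - by rewrite eqxx (eq_sym b a) (negPf ab) eq_sym (negPf eb).
right; pose B := [set a; b; e].
have B3 : #|B| = 3.
  by rewrite /B setUC cardsU1 !inE negb_or ea eb cards2 ab.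
apply/imsetP; exists B; first by rewrite inE subsetT B3.
have sub (S : {set 'I_4}) : 2 <= #|S :&: B| -> S \in F.
  move=> S2; have [x [y [xS yS xB yB xy]]] : exists x y,
      [/\ x \in S, y \in S, x \in B, y \in B & x != y].
    have /card_gt1P[x [y [xSB ySB xy]]] := S2.
    exists x, y; move: xSB ySB; rewrite !(in_setI, xy).
    by move=> /andP[-> ->] /andP[-> ->].
  have : [set x; y] \in F; last by apply: up; rewrite subUset !sub1set xS.
  move: xB yB xy; rewrite !inE -!orbA.
  case/or3P=> /eqP-> /or3P[]/eqP->; rewrite ?eqxx // => _ //;
    by rewrite setUC.
apply/setP => S; rewrite mem_triangle_system //; apply/idP/idP; last exact: sub.
(* A set with at most one point of [B] has a complement with at least two, so self-duality excludes
   it. *)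
apply: contraLR; rewrite -ltnNge => S1; rewrite -sdF.2; apply: sub.
have := cardsID S B; rewrite setDE ![B :&: _]setIC B3.
by move: #|_| #|_| S1 => k m; clear; lia.
Qed.

Lemma card_extremal_families_4 (Q : nat) :
  3 <= Q -> #|extremal_families Q 4| = 8.
Proof.
move=> Q3; rewrite extremal_families_4 // cardsU card_imset; last exact: one_flip_star_inj.
rewrite (card_in_imset triangle_system_inj) cards_draws cardsT !card_ord.
have -> : 'C(4, 3) = 4 by [].
rewrite (_ : _ :&: _ = set0) ?cards0 //.
apply/setP => F; rewrite !inE; apply/negP => /andP[/imsetP[a _ ->] /imsetP[B]].
by rewrite inE subsetT => /eqP B3 /esym; apply: triangle_system_neq_one_flip_star.
Qed.

(** * Three points, the case [Q = 2], and the conclusion *)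

Lemma one_flip_star_3 (a : 'I_3) :
  one_flip_star a = [set S : {set 'I_3} | 2 <= #|S|].
Proof.
apply/setP => S; rewrite mem_one_flip_star inE; case: ifP => aS.
  rewrite (cardsD1 a) aS add1n ltnS card_gt0 setD_eq0; congr negb.
  by rewrite eqEsubset sub1set aS andbT.
have sub : S \subset ~: [set a] by rewrite subsetC sub1set inE aS.
rewrite eqEcard sub /=; by rewrite cardsC1 card_ord.
Qed.

Lemma pairs_and_triple_3E : pairs_and_triple_3 = [set S : {set 'I_3} | 2 <= #|S|].
Proof.
have E (i : 'I_3) : [|| i == inord 0, i == inord 1 | i == inord 2].
  by rewrite -!val_eqE /= !inordK //; case: i => -[|[|[|]]].
have n01 : (inord 0 : 'I_3) != inord 1 by rewrite -val_eqE /= !inordK.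
have n02 : (inord 0 : 'I_3) != inord 2 by rewrite -val_eqE /= !inordK.
have n12 : (inord 1 : 'I_3) != inord 2 by rewrite -val_eqE /= !inordK.
rewrite /pairs_and_triple_3; move: (inord 0) (inord 1) (inord 2) E n01 n02 n12.
move=> x y z E xy xz yz; apply/setP => S; rewrite !inE; apply/idP/idP.
  rewrite -!orbA => /or4P[]/eqP->; rewrite ?cards2 ?xy ?xz ?yz //.
  by rewrite setUC cardsU1 cards2 xy addn2.
move=> S2; have [->|ST] := eqVneq S setT.
  suff -> : [set x; y; z] = setT by rewrite eqxx !orbT.
  by apply/setP => i; rewrite !inE -orbA E.
have [w wS] : exists w, w \notin S.
  have /subsetPn[w _ wS] : ~~ (setT \subset S) by rewrite subTset.
  by exists w.
(* On three points, a set with at least two elements that misses [w] must be the complement of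
   [w]. *)
have {wS S2 ST} -> : S = ~: [set w].
  apply/eqP; rewrite eqEcard subsetC sub1set inE wS /=; move: S2.
  by rewrite cardsC1 card_ord.
suff : [|| [set x; y] == ~: [set w], [set x; z] == ~: [set w]
         | [set y; z] == ~: [set w]].
  by case/or3P => /eqP->; rewrite eqxx ?orbT.
have C (u v t : 'I_3) : u != v -> u != t -> v != t -> [set u; v] == ~: [set t].
  move=> uv ut vt; rewrite eqEcard; apply/andP; split.
    by rewrite subUset !sub1set !inE ut.
  by rewrite cards2 uv cardsC1 card_ord.
case/or3P: (E w) => /eqP->; apply/or3P.
- by apply: Or33; apply: C; rewrite // eq_sym.
- by apply: Or32; apply: C; rewrite // eq_sym.
- by apply: Or31; apply: C.
Qed.

(** On three points each pair is the complement of a singleton, so self-duality makes every pair a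
    member. *)
Lemma extremal_families_3 (Q : nat) :
  3 <= Q -> extremal_families Q 3 = [set pairs_and_triple_3].
Proof.
move=> Q3; apply/setP => F; rewrite in_set1 pairs_and_triple_3E -(one_flip_star_3 ord0).
apply/idP/eqP => [extF|->]; last first.
  by rewrite inE one_flip_star_nontrivial // Lambda_one_flip_star ?eqxx ?(ltnW Q3).
have maxF := extremal_maximal (ltnW Q3) (isT : 2 < 3) extF.
have sdF := maximal_self_dual (isT : 0 < 3) maxF.
move: extF; rewrite inE => /andP[ntF _].
have F1 x := nontrivial_notin_set1 x ntF.
apply: one_flip_star_unique => // c c0.
have c1 : #|~: [set ord0; c]| == 1.
  by have := cardsC [set ord0; c]; rewrite cards2 card_ord eq_sym c0; lia.
by have /cards1P[d e] := c1; rewrite -[_ |: _]setCK e sdF.2.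
Qed.

(** All weights are [1], and self-duality selects exactly half of all subsets. *)
Lemma Lambda_2_maximal (n : nat) (F : {set {set 'I_n}}) :
  0 < n -> maximal_intersecting F -> Lambda 2 F = 2 ^ (n - 1).
Proof.
move=> n0 /(maximal_self_dual n0) sdF; rewrite Lambda_co_weight subn1 /=.
have := @co_weight_dual _ 1 setT (fun S => S \in F) (fun S => S \in F).
move=> /(_ (fun S _ => etrans (congr1 (fun S => S \in F) (setTD S)) (sdF.2 S))).
have -> : in_weight 1 setT (fun S => S \in F) = co_weight 1 setT (fun S => S \in F).
  by apply: eq_bigr => S _; rewrite !exp1n.
have -> : 2 ^ #|[set: 'I_n]| = (2 ^ (n - 1)).*2.
  by rewrite cardsT card_ord -mul2n -expnS subn1 prednK.
by rewrite addnn => /double_inj.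
Qed.

Theorem corollary1p3 (Q : nat) (hQ : 2 <= Q) :
  (forall n : nat, 3 <= n ->
     (forall F : {set {set 'I_n}},
        nontrivial_intersecting F -> Lambda Q F <= Lambda_bound Q n) /\
     (forall a : 'I_n,
        nontrivial_intersecting (one_flip_star a) /\
        Lambda Q (one_flip_star a) = Lambda_bound Q n)) /\
  (3 <= Q ->
     (forall n : nat, 5 <= n ->
        extremal_families Q n = [set one_flip_star a | a : 'I_n] /\
        injective (@one_flip_star n)) /\
     (extremal_families Q 4 =
        [set one_flip_star a | a : 'I_4] :|:
        [set triangle_system B | B in subsets_of_card [set: 'I_4] 3] /\
      #|extremal_families Q 4| = 8) /\
     (extremal_families Q 3 = [set pairs_and_triple_3] /\
      (forall a : 'I_3, one_flip_star a = pairs_and_triple_3))) /\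
  (Q = 2 ->
     forall (n : nat) (F : {set {set 'I_n}}), 3 <= n ->
       maximal_intersecting F -> nontrivial_intersecting F ->
       Lambda Q F = Lambda_bound Q n).
Proof.
split=> [n n3|]; first split=> [F|a].
- exact: nontrivial_Lambda_le.
- by split; [apply: one_flip_star_nontrivial | apply: Lambda_one_flip_star].
split=> [Q3|-> n F n3 maxF _]; last first.
  have n0 : 0 < n by lia.
  (* At [Q = 2] the bound reads [2 ^ (n - 1) - 1 + 1]. *)
  rewrite Lambda_2_maximal // /Lambda_bound exp1n subnK //.
  by rewrite expn_gt0.
split=> [n n5|].
  by split; [apply: extremal_families_ge5 | apply: one_flip_star_inj; apply: ltnW].
split; first by split; [apply: extremal_families_4 | apply: card_extremal_families_4].
split=> [|a]; first exact: extremal_families_3.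
by rewrite one_flip_star_3 pairs_and_triple_3E.
Qed.
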